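(* For every real number $x>0$, $$\exp\left\{-\frac{1}{2}\psi(\delta_*(x))\right\}<\frac{\Gamma(x)}{x^xe^{-x}\sqrt{2\pi}}<\exp\left\{-\frac{1}{2}\psi(\delta^*(x))\right\},$$ where $$\delta_*(x)=x+\frac{1}{3}\quad\text{and}\quad \delta^*(x)=\frac{1}{2}\cdot\frac{1}{(x+1)\log(1+1/x)-1}.$$
   Context: $\Gamma(x)=\int_0^\infty u^{x-1}e^{-u}\,du$ for real $x>0$ is the gamma function, $\psi(x)=\Gamma'(x)/\Gamma(x)$ for $x>0$ is the digamma function, and $\log$ is the natural logarithm. *)

(* Defs.v *)
From HB Require Import structures.
From mathcomp Require Import all_boot all_order all_algebra.
From mathcomp Require Import all_classical all_reals all_analysis.

Set Implicit Arguments.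
Unset Strict Implicit.
Unset Printing Implicit Defensive.

Import Order.TTheory GRing.Theory Num.Theory.
Import numFieldNormedType.Exports.

Local Open Scope classical_set_scope.
Local Open Scope ring_scope.

(* Lebesgue integral; the real-valued integral is 0 by convention when the
   integral diverges, so only the values at x > 0 are meaningful. *)
Definition Gamma (R : realType) (x : R) : R :=
  \int[@lebesgue_measure R]_(u in `]0, +oo[) (u `^ (x - 1) * expR (- u)).

Definition digamma (R : realType) (x : R) : R :=
  derive1 (@Gamma R) x / Gamma x.

Definition delta_lower (R : realType) (x : R) : R := x + 1 / 3.

Definition delta_upper (R : realType) (x : R) : R :=
  1 / 2 * (1 / ((x + 1) * ln (1 + 1 / x) - 1)).

(* Main.v *)
Require Import Defs.
From HB Require Import structures.
From mathcomp Require Import all_boot all_order all_algebra.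
From mathcomp Require Import all_classical all_reals all_analysis.
From mathcomp Require Import measurable_realfun ring lra.

Set Implicit Arguments.
Unset Strict Implicit.
Unset Printing Implicit Defensive.

Import Order.TTheory GRing.Theory Num.Theory.
Import numFieldNormedType.Exports.

Local Open Scope classical_set_scope.
Local Open Scope ring_scope.

(** Write d for delta_upper, f = ln Gamma - x ln x + x - ln(2 pi)/2 and
    g(x) = (x+1) ln(1+1/x) - 1, so that f(x) - f(x+1) = g(x) and d = 1/(2g).
    The functions D = f + psi(x+1/3)/2 and E = f + psi(d)/2 tend to 0 along
    x + n. Since psi(y+1) = psi(y) + 1/y, D(x) - D(x+1) = g(x) - 1/(2x+2/3) > 0,
    hence D > 0; and E(x) - E(x+1) = (psi(d(x)+1) - psi(d(x+1)))/2 < 0, hence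
    E < 0, because psi increases and the derivative of d exceeds 1. The inequality
    Gamma(x+h) <= x^h Gamma(x) for 0 <= h <= 1 gives the differentiability of
    ln Gamma, the estimate psi(x) = ln x + O(1/x) and, with Legendre's duplication
    formula at the integers, Stirling's formula. *)

(** The function d is chosen so that 1/(2d) = g; thus psi(d) + 2g = psi(d + 1), and the one-step
    difference of E only compares psi at two points. The hard point is d' > 1, that is 2 g^2 < 1/x -
    ln(1 + 1/x), where the two sides agree to leading order 1/(2x^2) at infinity. Differentiation
    under the integral sign is avoided: after the basic integrals, [Gamma] enters only through its
    functional equation, its values at 1 and 1/2, and one pointwise convexity inequality. Even the
    monotonicity of psi comes from its recurrence and its logarithmic asymptotics. Limits at
    infinity are carried as explicit bounds c/(y - 1) for y > 1, the form in which one descent lemma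
    turns a one-step difference into a sign. *)

(** * Improper integrals over the positive axis *)

(** The half-lines [A n] increase to the positive axis; the fundamental theorem applies on each of
    them, and monotone convergence passes to the union. *)
Lemma ge0_continuous_FTC0y (R : realType) (f F : R -> R) (a l : R) :
  (forall u : R, 0 < u -> 0 <= f u) ->
  (forall u : R, 0 < u -> {for u, continuous f}) ->
  (forall u : R, 0 < u -> is_derive u 1 F (f u)) ->
  F u @[u --> (0:R)^'+] --> a -> F u @[u --> +oo] --> l ->
  (\int[@lebesgue_measure R]_(u in `]0%R, +oo[) (f u)%:E = (l - a)%:E)%E.
Proof.
move=> f0 cf dF Fa Fl.
pose A (n : nat) : set R := `[n.+1%:R^-1, +oo[%classic.
have UA : \bigcup_i A i = `]0, +oo[%classic.
  apply/seteqP; split => u /=.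
    by move=> [n _] /=; rewrite /A/= !in_itv/= !andbT; apply: lt_le_trans.
  rewrite in_itv/= andbT => u0; exists (Num.truncn u^-1) => //.
  rewrite /A/= in_itv/= andbT invf_ple ?posrE ?ltr0n//.
  exact/ltW/truncnS_gt.
have A0 n u : A n u -> 0 < u.
  by rewrite /A/= in_itv/= andbT; apply: lt_le_trans.
have cfw n : {within A n, continuous f}.
  by apply: continuous_in_subspaceT => u; rewrite inE => /A0 /cf.
have ndA : nondecreasing_seq A.
  apply/nondecreasing_seqP => n; rewrite subsetEset => u.
  rewrite /A/= !in_itv/= !andbT; apply: le_trans.
  by rewrite lef_pV2 ?posrE ?ltr0n// ler_nat.
have intA n : (\int[@lebesgue_measure R]_(u in A n) (f u)%:E =
    (l - F n.+1%:R^-1)%:E)%E.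
  have n0 : 0 < n.+1%:R^-1 :> R by rewrite invr_gt0 ltr0n.
  rewrite /A (ge0_continuous_FTC2y (F := F) (l := l)) ?EFinB//.
  - by move=> x nx; apply: f0; exact: lt_le_trans nx.
  - exact: cfw.
  - by move=> x nx; have [] := dF _ (lt_trans n0 nx).
  - apply: cvg_at_right_filter; apply: differentiable_continuous.
    by apply/derivable1_diffP; have [] := dF _ n0.
  - move=> x; rewrite in_itv/= andbT => nx; rewrite derive1E.
    by have [_ ->] := dF _ (lt_trans n0 nx).
have := @ge0_nondecreasing_set_cvg_integral _ (measurableTypeR R) R A
  (EFin \o f) lebesgue_measure ndA.
rewrite UA => H.
have {}H : (l - F n.+1%:R^-1)%:E @[n --> \oo] -->
    (\int[@lebesgue_measure R]_(u in `]0%R, +oo[) (f u)%:E)%E.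
  rewrite -(funext intA); apply: H.
  - by move=> i; exact: measurable_itv.
  - move=> i; apply/measurable_EFinP.
    by apply: subspace_continuous_measurable_fun => //; exact: measurable_itv.
  - by move=> i x /A0 /f0; rewrite lee_fin.
apply: (cvg_unique _ H) => //.
apply/cvg_EFin; first by apply: nearW.
apply: cvgB; first exact: cvg_cst.
apply: cvg_comp Fa.
move=> B [e /= e0 Be].
have := @cvg_harmonic R => /cvgrPdist_lt/(_ e e0) [N _ HN].
by exists N => // n /HN /= h; apply: Be => //=.
Qed.

Section positive_integrals.
Variable R : realType.
Implicit Types (f g F : R -> R) (v w c a l : R).

Let D : set R := `]0%R, +oo[%classic.

Let D0 u : D u -> 0 < u. Proof. by rewrite /D/= in_itv/= andbT. Qed.

(** The identity in the extended reals with a finite [v] records convergence as well as the value,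
    so sums, multiples and comparisons need no separate integrability condition. *)
Definition pos_integral f v :=
  [/\ forall u, 0 < u -> 0 <= f u,
      forall u, 0 < u -> {for u, continuous f} &
      (\int[@lebesgue_measure R]_(u in `]0%R, +oo[) (f u)%:E = v%:E)%E].

Let mD : measurable (D : set (measurableTypeR R)).
Proof. exact: measurable_itv. Qed.

Let mf f : (forall u, 0 < u -> {for u, continuous f}) ->
  measurable_fun (D : set (measurableTypeR R)) (EFin \o f).
Proof.
move=> cf; apply/measurable_EFinP; apply: open_continuous_measurable_fun => //.
by move=> u; rewrite inE => /D0 /cf.
Qed.

Let f0E f : (forall u, 0 < u -> 0 <= f u) ->
  forall u, D u -> (0 <= (f u)%:E)%E.
Proof. by move=> f0 u /D0 /f0; rewrite lee_fin. Qed.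

Lemma pos_integral_FTC f F a l :
  (forall u, 0 < u -> 0 <= f u) ->
  (forall u, 0 < u -> {for u, continuous f}) ->
  (forall u : R, 0 < u -> is_derive u 1 F (f u)) ->
  F u @[u --> (0:R)^'+] --> a -> F u @[u --> +oo] --> l ->
  pos_integral f (l - a).
Proof.
move=> f0 cf dF Fa Fl; split=> //.
exact: ge0_continuous_FTC0y dF Fa Fl.
Qed.

Lemma pos_integralD f g v w : pos_integral f v -> pos_integral g w ->
  pos_integral (fun u => f u + g u) (v + w).
Proof.
move=> [f0 cf If] [g0 cg Ig]; split.
- by move=> u u0; rewrite addr_ge0 ?f0 ?g0.
- by move=> u u0; apply: continuousD; [exact: cf | exact: cg].
- under eq_integral do rewrite EFinD.
  rewrite (ge0_integralD _ mD).
  + by rewrite If Ig.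
  + exact: f0E.
  + exact: mf.
  + exact: f0E.
  + exact: mf.
Qed.

Lemma pos_integralZ f v c : 0 <= c -> pos_integral f v ->
  pos_integral (fun u => c * f u) (c * v).
Proof.
move=> c0 [f0 cf If]; split.
- by move=> u u0; rewrite mulr_ge0 ?f0.
- move=> u u0; apply: continuousM; [exact: cst_continuous | exact: cf].
- under eq_integral do rewrite EFinM.
  rewrite (ge0_integralZl_EFin _ mD) ?If//.
  + exact: f0E.
  + exact: mf.
Qed.

Lemma pos_integral_le f g v w : pos_integral f v -> pos_integral g w ->
  (forall u, 0 < u -> f u <= g u) -> v <= w.
Proof.
move=> [f0 cf If] [g0 cg Ig] fg; rewrite -lee_fin -If -Ig.
apply: (ge0_le_integral _ mD).
- exact: f0E.
- exact: mf.
- exact: mf.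
- by move=> u /D0 /fg; rewrite lee_fin.
Qed.

Lemma pos_integral_uniq f g v w : pos_integral f v -> pos_integral g w ->
  (forall u, 0 < u -> f u = g u) -> v = w.
Proof.
move=> If Ig fg; apply/le_anti/andP; split.
  by apply: (pos_integral_le If Ig) => u /fg ->.
by apply: (pos_integral_le Ig If) => u /fg ->.
Qed.

(** The real-valued integral is 0 when the extended one is infinite; domination excludes this, so
    the real integral is the true value. *)
Lemma pos_integral_dom f g w : pos_integral g w ->
  (forall u, 0 < u -> 0 <= f u) ->
  (forall u, 0 < u -> {for u, continuous f}) ->
  (forall u, 0 < u -> f u <= g u) ->
  pos_integral f (\int[@lebesgue_measure R]_(u in `]0%R, +oo[) f u).
Proof.
move=> [g0 cg Ig] f0 cf fg; split=> //.
rewrite /Rintegral fineK// ge0_fin_numE.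
  rewrite (@le_lt_trans _ _ w%:E) ?ltry// -Ig.
  apply: (ge0_le_integral _ mD).
  - exact: f0E.
  - exact: mf.
  - exact: mf.
  - by move=> u /D0 /fg; rewrite lee_fin.
by apply: integral_ge0 => u uD; exact: f0E.
Qed.

End positive_integrals.

(** * The Gamma integral: convergence, functional equation, value at 1 *)

Section gamma_kernel.
Variable R : realType.
Implicit Types (x u h a b : R).

Lemma is_derive_expR_comp (g : R -> R) u (d : R) : is_derive u 1 g d ->
  is_derive u 1 (fun t => expR (g t)) (expR (g u) * d).
Proof. by move=> dg; exact: (@is_derive1_comp R expR g u). Qed.

Lemma is_derive_ln_comp (g : R -> R) u (d : R) : 0 < g u -> is_derive u 1 g d ->
  is_derive u 1 (fun t => ln (g t)) ((g u)^-1 * d).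
Proof.
move=> gu dg; have H := is_derive1_ln gu.
exact: (@is_derive1_comp R (@ln R) g u).
Qed.

Lemma is_derive_expR_lnlin a b u : 0 < u ->
  is_derive u 1 (fun t => expR (a * ln t + b * t))
    ((a / u + b) * expR (a * ln u + b * u)).
Proof.
move=> u0.
have h1 : is_derive u 1 (fun t : R => a * ln t + b * t) (a / u + b).
  have := is_derive1_ln u0 => H.
  by apply: is_derive_eq; rewrite /GRing.scale/=; ring.
by have := is_derive_expR_comp h1; rewrite mulrC.
Qed.

(** Only positive [u] matter: there this is the integrand of [Gamma], with the power moved into the
    exponent so that products become sums. The factor [-1] gives the shape required by
    [is_derive_expR_lnlin]. *)
Definition gamma_fun x u := expR ((x - 1) * ln u + (-1) * u).

Lemma gamma_fun_gt0 x u : 0 < gamma_fun x u.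
Proof. exact: expR_gt0. Qed.

Lemma continuous_gamma_fun x u : 0 < u -> {for u, continuous (gamma_fun x)}.
Proof.
move=> u0; apply: differentiable_continuous; apply/derivable1_diffP.
by have [] := is_derive_expR_lnlin (x - 1) (-1) u0.
Qed.

Lemma gamma_funS x u : 0 < u -> gamma_fun (x + 1) u = u * gamma_fun x u.
Proof.
by move=> u0; rewrite /gamma_fun -{3}(lnK u0) -expRD; congr expR; ring.
Qed.

Lemma GammaE x :
  Gamma x = \int[@lebesgue_measure R]_(u in `]0%R, +oo[) gamma_fun x u.
Proof.
apply: eq_Rintegral => u; rewrite inE/= in_itv/= andbT => u0.
by rewrite /gamma_fun /powR gt_eqF// mulN1r expRD.
Qed.

(* Its derivative dominates the integrand of Gamma, up to a constant, both
   near 0 and near infinity. *)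
Definition ratio_pow x u := expR (x * (ln u - ln (1 + u))).

(** This is x u^(x-1) / (1+u)^(x+1), the derivative of (u / (1+u))^x. *)
Definition ratio_pow' x u := x * expR ((x - 1) * ln u - (x + 1) * ln (1 + u)).

Lemma is_derive_ln1D u : 0 < u ->
  is_derive u 1 (fun t => ln (1 + t)) (1 + u)^-1.
Proof.
move=> u0.
have u1 : 0 < 1 + u by rewrite addr_gt0.
have h : is_derive u 1 (fun t : R => 1 + t) 1.
  by apply: is_derive_eq; rewrite add0r mulr1.
by have := is_derive_ln_comp u1 h; rewrite mulr1.
Qed.

Lemma is_derive_ratio_pow x u : 0 < u ->
  is_derive u 1 (ratio_pow x) (ratio_pow' x u).
Proof.
move=> u0; have u1 : 0 < 1 + u by rewrite addr_gt0.
have h1 : is_derive u 1 (fun t : R => x * (ln t - ln (1 + t)))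
    (x * (u^-1 - (1 + u)^-1)).
  have H := is_derive1_ln u0; have H1 := is_derive_ln1D u0.
  exact: is_derive_eq.
have := is_derive_expR_comp h1.
rewrite /ratio_pow' => H; apply: (is_derive_eq H).
have -> : u^-1 - (1 + u)^-1 = expR (- ln u - ln (1 + u)).
  rewrite expRD !expRN !lnK//; field.
  by rewrite !gt_eqF.
by rewrite mulrCA -expRD; congr (_ * expR _); ring.
Qed.

Lemma ratio_pow'_ge0 x u : 0 < x -> 0 <= ratio_pow' x u.
Proof. by move=> x0; rewrite mulr_ge0 ?expR_ge0 ?ltW. Qed.

Lemma continuous_ratio_pow' x u : 0 < u ->
  {for u, continuous (ratio_pow' x)}.
Proof.
move=> u0; apply: differentiable_continuous; apply/derivable1_diffP.
have H := is_derive1_ln u0; have H1 := is_derive_ln1D u0.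
have h1 : is_derive u 1 (fun t : R => (x - 1) * ln t - (x + 1) * ln (1 + t))
    ((x - 1) / u - (x + 1) / (1 + u)) by exact: is_derive_eq.
have h2 := is_derive_expR_comp h1.
have : is_derive u 1 (fun t : R => x * expR ((x - 1) * ln t - (x + 1) * ln (1 + t)))
  (x * (expR ((x - 1) * ln u - (x + 1) * ln (1 + u)) *
        ((x - 1) / u - (x + 1) / (1 + u)))).
  exact: is_derive_eq.
by case.
Qed.

(** The factor exp(c u) is at most 1, and u^x < e as soon as u < e^(1/x). *)
Lemma expR_lnlin_cvg0 x c : 0 < x ->
  (forall u, 0 < u -> c u <= 0) ->
  expR (x * ln u + c u) @[u --> (0:R)^'+] --> (0:R).
Proof.
move=> x0 c0; apply/cvgrPdist_lt => e e0.
have d0 : 0 < expR (ln e / x) by exact: expR_gt0.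
near=> u.
have u0 : 0 < u by near: u; exact: nbhs_right_gt.
rewrite sub0r normrN ger0_norm ?expR_ge0//.
rewrite -[ltRHS](lnK e0) ltr_expR.
rewrite -[ltRHS]addr0 ltr_leD ?c0// mulrC -ltr_pdivlMr//.
rewrite -[ltRHS]expRK ltr_ln ?posrE//.
Unshelve. all: end_near. Qed.

Lemma ratio_pow_cvg0 x : 0 < x -> ratio_pow x u @[u --> (0:R)^'+] --> (0:R).
Proof.
move=> x0.
under eq_fun do rewrite /ratio_pow mulrBr.
apply: expR_lnlin_cvg0 => // u u0.
by rewrite oppr_le0 mulr_ge0 ?(ltW x0)// ln_ge0// lerDl ltW.
Qed.

Lemma ln_le_subr1 u : 0 < u -> ln u <= u - 1.
Proof.
move=> u0; have := @le_ln1Dx R (u - 1).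
by rewrite addrCA subrr addr0; apply; lra.
Qed.

Lemma ln_le_div a u : 0 < a -> 0 < u -> ln u <= ln a + (u / a - 1).
Proof.
move=> a0 u0; rewrite -lerBlDl -ln_div ?posrE//.
by rewrite ln_le_subr1// divr_gt0.
Qed.

(** The function lies between 1 - x/u and 1, since ln(1+u) - ln u <= 1/u. *)
Lemma ratio_pow_cvgy x : 0 < x -> ratio_pow x u @[u --> +oo] --> (1:R).
Proof.
move=> x0; apply/cvgrPdist_lt => e e0.
near=> u.
have u0 : 0 < u by near: u; apply: nbhs_pinfty_gt; exact: num_real.
have u1 : 0 < 1 + u by rewrite addr_gt0.
have xe : x / e < u by near: u; apply: nbhs_pinfty_gt; exact: num_real.
have r1 : ratio_pow x u <= 1.
  rewrite -expR0 ler_expR mulr_ge0_le0 ?(ltW x0)// subr_le0.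
  by rewrite ler_ln ?posrE// lerDr.
rewrite ger0_norm ?subr_ge0// ltrBlDl.
have h := expR_ge1Dx (x * (ln u - ln (1 + u))).
rewrite -ltrBlDr; apply: lt_le_trans h; rewrite ltrD2l ltrNl -mulrN opprB.
have : ln (1 + u) - ln u <= u^-1.
  rewrite lerBlDl (le_trans (ln_le_div u0 u1))// lerD2l.
  by rewrite mulrDl divff ?gt_eqF// mul1r addrK.
move=> /(ler_wpM2l (ltW x0)) /le_lt_trans; apply.
by rewrite ltr_pdivrMr// mulrC -ltr_pdivrMr.
Unshelve. all: end_near. Qed.

Lemma pos_integral_ratio_pow' x : 0 < x -> pos_integral (ratio_pow' x) 1.
Proof.
move=> x0; rewrite -(subr0 1).
apply: (@pos_integral_FTC R (ratio_pow' x) (ratio_pow x) 0 1).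
- by move=> u _; exact: ratio_pow'_ge0.
- by move=> u u0; exact: continuous_ratio_pow'.
- by move=> u u0; exact: is_derive_ratio_pow.
- exact: ratio_pow_cvg0.
- exact: ratio_pow_cvgy.
Qed.

(** The maximum of (1+u)^(x+1) e^(-u) over u > 0, attained at u = x. *)
Definition gamma_bound x := expR ((x + 1) * ln (x + 1) - x).

(** The logarithm lies below its tangent line at x + 1. *)
Lemma ln1D_gamma_bound x u : 0 < x -> 0 < u ->
  expR ((x + 1) * ln (1 + u) - u) <= gamma_bound x.
Proof.
move=> x0 u0; rewrite ler_expR.
have x1 : 0 < x + 1 by rewrite addr_gt0.
have u1 : 0 < 1 + u by rewrite addr_gt0.
have := ler_wpM2l (ltW x1) (ln_le_div x1 u1).
have -> : (x + 1) * (ln (x + 1) + ((1 + u) / (x + 1) - 1)) =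
  (x + 1) * ln (x + 1) + (u - x) by field; rewrite gt_eqF.
lra.
Qed.

Lemma gamma_fun_le x u : 0 < x -> 0 < u ->
  gamma_fun x u <= gamma_bound x / x * ratio_pow' x u.
Proof.
move=> x0 u0; rewrite /ratio_pow' mulrA divfK ?gt_eqF//.
rewrite -ler_pdivrMr ?expR_gt0// -expRN -expRD.
apply: le_trans (ln1D_gamma_bound x0 u0).
by rewrite ler_expR; lra.
Qed.

Lemma pos_integral_gamma_fun x : 0 < x -> pos_integral (gamma_fun x) (Gamma x).
Proof.
move=> x0; rewrite GammaE.
apply: (pos_integral_dom (g := fun u => gamma_bound x / x * ratio_pow' x u)).
- apply: pos_integralZ (pos_integral_ratio_pow' x0).
  by rewrite divr_ge0 ?expR_ge0 ?ltW.
- by move=> u _; exact/ltW/gamma_fun_gt0.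
- by move=> u; exact: continuous_gamma_fun.
- by move=> u; exact: gamma_fun_le.
Qed.

Lemma gamma_funS_cvg0 x : 0 < x -> gamma_fun (x + 1) u @[u --> (0:R)^'+] --> (0:R).
Proof.
move=> x0; under eq_fun do rewrite /gamma_fun addrK.
apply: (expR_lnlin_cvg0 (c := fun u => -1 * u)) => // u u0.
by rewrite mulN1r oppr_le0 ltW.
Qed.

(** Replacing u^x by (1+u)^x leaves at most [gamma_bound x] / (1+u). *)
Lemma gamma_funS_cvgy x : 0 < x -> gamma_fun (x + 1) u @[u --> +oo] --> (0:R).
Proof.
move=> x0; apply/cvgrPdist_lt => e e0.
near=> u.
have u0 : 0 < u by near: u; apply: nbhs_pinfty_gt; exact: num_real.
have u1 : 0 < 1 + u by rewrite addr_gt0.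
have Ce : gamma_bound x / e < u by near: u; apply: nbhs_pinfty_gt; exact: num_real.
rewrite sub0r normrN ger0_norm ?expR_ge0//.
apply: (@le_lt_trans _ _ (gamma_bound x / (1 + u))).
  rewrite ler_pdivlMr// -{1}(lnK u1) -expRD.
  apply: le_trans (ln1D_gamma_bound x0 u0); rewrite ler_expR.
  have : x * ln u <= x * ln (1 + u).
    by rewrite ler_pM2l// ler_ln ?posrE// lerDr.
  lra.
rewrite ltr_pdivrMr// mulrC -ltr_pdivrMr// (lt_trans Ce)//.
by rewrite ltrDr.
Unshelve. all: end_near. Qed.

(** This is integration by parts, but the derivative of u^x e^(-u) changes sign. Adding [c] times
    the derivative of [ratio_pow (x + 1)], which dominates the negative term, gives a nonnegative
    integrand [K']; the extra mass [c] cancels at the end. *)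
Lemma GammaS x : 0 < x -> Gamma (x + 1) = x * Gamma x.
Proof.
move=> x0; have x1 : 0 < x + 1 by rewrite addr_gt0.
pose c := gamma_bound (x + 1) / (x + 1).
have c0 : 0 <= c by rewrite divr_ge0 ?expR_ge0 ?ltW.
pose K u := gamma_fun (x + 1) u + c * ratio_pow (x + 1) u.
pose K' u := x * gamma_fun x u +
  (c * ratio_pow' (x + 1) u - gamma_fun (x + 1) u).
have IK : pos_integral K' (c - 0).
  apply: (@pos_integral_FTC R K' K 0 c).
  - move=> u u0; rewrite addr_ge0//.
      by rewrite mulr_ge0 ?(ltW x0)// ltW// gamma_fun_gt0.
    by rewrite subr_ge0 gamma_fun_le.
  - move=> u u0; apply: continuousD.
      apply: continuousM; first exact: cst_continuous.
      exact: continuous_gamma_fun.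
    apply: continuousB; last exact: continuous_gamma_fun.
    apply: continuousM; first exact: cst_continuous.
    exact: continuous_ratio_pow'.
  - move=> u u0.
    have H1 := is_derive_expR_lnlin (x + 1 - 1) (-1) u0.
    have H2 := is_derive_ratio_pow (x + 1) u0.
    apply: is_derive_eq.
    rewrite -/(gamma_fun (x + 1) u) /K' /GRing.scale/= !gamma_funS// addrK.
    by field; rewrite gt_eqF.
  - rewrite [X in _ --> X](_ : 0 = 0 + c * 0); last by rewrite mulr0 addr0.
    apply: cvgD; first exact: gamma_funS_cvg0.
    by apply: cvgMl_tmp; exact: ratio_pow_cvg0.
  - rewrite [X in _ --> X](_ : c = 0 + c * 1); last by rewrite mulr1 add0r.
    apply: cvgD; first exact: gamma_funS_cvgy.
    by apply: cvgMl_tmp; exact: ratio_pow_cvgy.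
have I1 := pos_integralD IK (pos_integral_gamma_fun x1).
have I2 := pos_integralD (pos_integralZ (ltW x0) (pos_integral_gamma_fun x0))
  (pos_integralZ c0 (pos_integral_ratio_pow' x1)).
have := pos_integral_uniq I1 I2 => H.
have {}H : c - 0 + Gamma (x + 1) = x * Gamma x + c * 1.
  by apply: H => u u0; rewrite /K'; ring.
by move: H; rewrite subr0 mulr1 addrC => /addIr.
Qed.

Lemma Gamma1 : Gamma 1 = 1 :> R.
Proof.
have e0 : -1 * u @[u --> (0:R)^'+] --> (-1 * 0 : R).
  by apply: cvgMl_tmp; apply: cvg_at_right_filter; exact: cvg_id.
suff I : pos_integral (@gamma_fun 1) (0 - - expR (-1 * 0)).
  have := pos_integral_uniq (pos_integral_gamma_fun ltr01) I (fun u _ => erefl).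
  by rewrite mulr0 expR0 opprK add0r.
apply: (@pos_integral_FTC R (gamma_fun 1) (fun u => - expR (-1 * u))
  (- expR (-1 * 0)) 0).
- by move=> u _; exact/ltW/gamma_fun_gt0.
- by move=> u; exact: continuous_gamma_fun.
- move=> u u0.
  have h1 : is_derive u 1 (fun t : R => -1 * t) (-1).
    by apply: is_derive_eq; rewrite /GRing.scale/= mulr1.
  have h2 := is_derive_expR_comp h1.
  have h3 : is_derive u 1 (fun u => - expR (-1 * u)) (- (expR (-1 * u) * -1)).
    exact: is_derive_eq.
  by apply: (is_derive_eq h3); rewrite /gamma_fun subrr mul0r add0r mulrN1 opprK.
- apply: cvgN; apply: continuous_cvg => //; exact: continuous_expR.
- rewrite -[X in _ --> X]oppr0; apply: cvgN.
  by under eq_fun do rewrite mulN1r; exact: cvgr_expR.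
Qed.

End gamma_kernel.

(** * The value at 1/2, from the Gaussian integral *)

Section gamma_half.
Variable R : realType.
Implicit Types (x u h v : R).
Import gauss_integral_proof.

Lemma is_derive_integral0_gauss x : 0 < x ->
  is_derive x 1 (@integral0_gauss R) (gauss_fun x).
Proof.
move=> x0.
have [dg dgE] : derivable (@integral0_gauss R) x 1 /\
    (@integral0_gauss R)^`()%classic x = gauss_fun x.
  apply: (@continuous_FTC1 R gauss_fun (BLeft 0) _ (x + 1)).
  - by rewrite ltrDl.
  - apply: continuous_compact_integrable => //; first exact: segment_compact.
    by apply: continuous_subspaceT; exact: continuous_gauss_fun.
  - by rewrite lte_fin.
  - exact: continuous_gauss_fun.
by apply: DeriveDef; [exact: dg | rewrite -derive1E dgE].
Qed.

Lemma integral0_gauss_cvg0 : integral0_gauss x @[x --> (0:R)^'+] --> (0:R).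
Proof.
have : {within `[0%R, 1%R], continuous (@integral0_gauss R)}.
  apply: parameterized_integral_continuous => //.
  apply: continuous_compact_integrable => //; first exact: segment_compact.
  by apply: continuous_subspaceT; exact: continuous_gauss_fun.
move=> /(continuous_within_itvP _ ltr01)[_ + _].
by rewrite /integral0_gauss set_itv1 Rintegral_set1.
Qed.

Lemma integral0_gauss_cvgy :
  @integral0_gauss R x @[x --> +oo] --> Num.sqrt pi / 2.
Proof.
have : Num.sqrt (@integral0_gauss R x ^+ 2) @[x --> +oo] --> Num.sqrt (pi / 4).
  apply: continuous_cvg; first exact: sqrt_continuous.
  exact: cvg_integral0_gauss_sqr.
rewrite sqrtrM ?pi_ge0// sqrtrV// (_ : 4 = 2 ^+ 2); last by rewrite expr2 -natrM.
rewrite sqrtr_sqr ger0_norm// (_ : (fun _ => Num.sqrt _) = integral0_gauss)//.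
apply/funext => r; rewrite sqrtr_sqr// ger0_norm//.
exact: integral0_gauss_ge0.
Qed.

(** The substitution u = t^2: [s] is the square root, and [P u] is twice the integral of e^(-t^2)
    from 0 to [s u]. *)
Lemma Gamma_half : Gamma (1 / 2) = Num.sqrt pi :> R.
Proof.
have h0 : 0 < 1 / 2 :> R by lra.
pose s u : R := expR (1 / 2 * ln u + 0 * u).
have s_gt0 u : 0 < s u by exact: expR_gt0.
have ds u : 0 < u -> is_derive u 1 s ((1 / 2 / u + 0) * s u).
  exact: is_derive_expR_lnlin.
pose P u : R := 2 * integral0_gauss (s u).
suff I : pos_integral (gamma_fun (1 / 2)) (2 * (Num.sqrt (pi : R) / 2) - 2 * 0).
  have := pos_integral_uniq (pos_integral_gamma_fun h0) I (fun u _ => erefl).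
  by move=> ->; field.
apply: (@pos_integral_FTC R (gamma_fun (1 / 2)) P).
- by move=> u _; exact/ltW/gamma_fun_gt0.
- by move=> u; exact: continuous_gamma_fun.
- move=> u u0.
  have d1 : is_derive u 1 (fun t => integral0_gauss (s t))
      (gauss_fun (s u) * ((1 / 2 / u + 0) * s u)).
    have H1 := is_derive_integral0_gauss (s_gt0 u).
    have H2 := ds _ u0.
    exact: (@is_derive1_comp R (@integral0_gauss R) s u).
  have d2 : is_derive u 1 P (2 * (gauss_fun (s u) * ((1 / 2 / u + 0) * s u))).
    exact: is_derive_eq.
  apply: (is_derive_eq d2); rewrite addr0.
  have -> : gauss_fun (s u) = expR (- u).
    rewrite /gauss_fun /s expr2 -expRD -[in RHS](lnK u0); congr (expR (- expR _)).
    by field.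
  have -> : gamma_fun (1 / 2) u = expR (- u) * (u^-1 * s u).
    rewrite /gamma_fun /s -{4}(lnK u0) -!expRN -!expRD; congr expR.
    by field.
  by field; rewrite gt_eqF.
- apply: cvgMl_tmp.
  apply: (cvg_comp s (@integral0_gauss R)) integral0_gauss_cvg0.
  have s0 : s u @[u --> (0:R)^'+] --> (0:R).
    by apply: (expR_lnlin_cvg0 (c := fun u => 0 * u)) => // u _; rewrite mul0r.
  move=> B [e /= e0 Be].
  near=> u; apply: Be => //=.
  near: u.
  by have /cvgrPdist_lt/(_ e e0) := s0.
- apply: cvgMl_tmp; apply: (cvg_comp s (@integral0_gauss R)) integral0_gauss_cvgy.
  apply/cvgryPgt => A.
  near=> u.
  have A0 : 0 < `|A| + 1 by rewrite ltr_pwDr.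
  have u0 : (`|A| + 1) ^+ 2 < u by near: u; apply: nbhs_pinfty_gt; exact: num_real.
  apply: (@lt_trans _ _ (`|A| + 1)).
    by rewrite (le_lt_trans (ler_norm A))// ltrDl.
  rewrite /s mul0r addr0 -[X in X < _](lnK A0) ltr_expR.
  have : ln ((`|A| + 1) ^+ 2) < ln u.
    by rewrite ltr_ln ?posrE ?exprn_gt0// (lt_trans _ u0)// exprn_gt0.
  rewrite lnXn//; lra.
Unshelve. all: end_near. Qed.

End gamma_half.

(** * Wendel's inequality and positivity *)

Section wendel.
Variable R : realType.
Implicit Types (x u h v : R).

(** After division by exp(h v), the bound 1 + t <= exp(t) is used at t = - h v and at t = (1-h) v;
    the weighted sum of the two lower bounds is exactly 1. *)
Lemma expR_convex h v : 0 <= h <= 1 ->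
  expR (h * v) <= (1 - h) + h * expR v.
Proof.
move=> /andP[h0 h1].
have k0 : 0 <= 1 - h by rewrite subr_ge0.
have e1 : expR v = expR (h * v) * expR ((1 - h) * v).
  by rewrite -expRD; congr expR; ring.
have e2 : 1 = expR (h * v) * expR (- (h * v)).
  by rewrite -expRD subrr expR0.
have a1 := ler_wpM2l k0 (expR_ge1Dx (- (h * v))).
have a2 := ler_wpM2l h0 (expR_ge1Dx ((1 - h) * v)).
have -> : (1 - h) + h * expR v =
    expR (h * v) * ((1 - h) * expR (- (h * v)) + h * expR ((1 - h) * v)).
  by rewrite e1 mulrDr [in RHS]mulrCA -e2 mulr1; congr (_ + _); exact: mulrCA.
rewrite ler_peMr ?expR_ge0//; apply: le_trans (lerD a1 a2).
by rewrite le_eqVlt; apply/orP; left; apply/eqP; ring.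
Qed.

(** The pointwise bound (u/x)^h <= (1-h) + h u/x is integrated against the kernel; by the functional
    equation the right-hand side integrates to Gamma(x). *)
Lemma Gamma_wendel x h : 0 < x -> 0 <= h <= 1 ->
  Gamma (x + h) <= expR (h * ln x) * Gamma x.
Proof.
move=> x0 h01; have /andP[h0 h1] := h01.
have x1 : 0 < x + 1 by rewrite addr_gt0.
have xh : 0 < x + h by rewrite ltr_pwDl.
have I1 := pos_integralZ (expR_ge0 (h * ln x)) (pos_integralD
  (@pos_integralZ _ _ _ (1 - h) _ (pos_integral_gamma_fun x0))
  (@pos_integralZ _ _ _ (h / x) _ (pos_integral_gamma_fun x1))).
have k0 : 0 <= 1 - h by rewrite subr_ge0.
have hx : 0 <= h / x by rewrite divr_ge0// ltW.
have := pos_integral_le (pos_integral_gamma_fun xh) (I1 k0 hx).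
have -> : (1 - h) * Gamma x + h / x * Gamma (x + 1) = Gamma x.
  by rewrite GammaS//; field; rewrite gt_eqF.
apply => u u0; rewrite gamma_funS//.
have -> : (1 - h) * gamma_fun x u + h / x * (u * gamma_fun x u) =
  ((1 - h) + h * expR (ln u - ln x)) * gamma_fun x u.
  by rewrite expRD expRN !lnK//; field; rewrite gt_eqF.
have -> : gamma_fun (x + h) u =
  expR (h * ln x) * (expR (h * (ln u - ln x)) * gamma_fun x u).
  by rewrite /gamma_fun -!expRD; congr expR; ring.
rewrite ler_pM2l ?expR_gt0// ler_pM2r ?gamma_fun_gt0//.
exact: expR_convex.
Qed.

(** For x <= 1, Wendel's inequality with h = 1 - x bounds Gamma(1) = 1 by a positive multiple of
    Gamma(x); the functional equation reaches larger x. *)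
Lemma Gamma_gt0 x : 0 < x -> 0 < Gamma x.
Proof.
move=> x0; have [n] : exists n : nat, x <= n.+1%:R.
  by exists (Num.truncn x); exact/ltW/truncnS_gt.
elim: n x x0 => [|n IH] x x0 xn.
  have h1 : 0 <= 1 - x <= 1 by apply/andP; split; lra.
  have := Gamma_wendel x0 h1; rewrite addrC subrK Gamma1 => h.
  have : 0 < expR ((1 - x) * ln x) * Gamma x by exact: lt_le_trans h.
  by rewrite pmulr_rgt0 ?expR_gt0.
have [x1|x1] := leP x n.+1%:R; first exact: IH.
have y0 : 0 < x - 1.
  by rewrite subr_gt0; apply: le_lt_trans x1; rewrite ler1n.
have -> : x = (x - 1) + 1 by rewrite subrK.
rewrite GammaS// mulr_gt0// IH//.
by rewrite lerBlDr -natr1 in xn *.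
Qed.

End wendel.

(** * Differentiability of ln Gamma; recurrence and asymptotics of digamma *)

Section digamma_properties.
Variable R : realType.
Implicit Types (x y h c d e : R).

Definition lnGamma x := ln (Gamma x).

Lemma expR_lnGamma x : 0 < x -> expR (lnGamma x) = Gamma x.
Proof. by move=> x0; rewrite /lnGamma lnK// posrE Gamma_gt0. Qed.

Lemma lnGammaS x : 0 < x -> lnGamma (x + 1) = lnGamma x + ln x.
Proof.
by move=> x0; rewrite /lnGamma GammaS// addrC lnM ?posrE// Gamma_gt0.
Qed.

Lemma lnGamma_le x h : 0 < x -> 0 <= h <= 1 ->
  lnGamma (x + h) <= lnGamma x + h * ln x.
Proof.
move=> x0 h01; have /andP[h0 h1] := h01.
have xh : 0 < x + h by rewrite ltr_pwDl.
rewrite [leRHS]addrC -[X in _ <= X + _]expRK -lnM ?posrE ?expR_gt0 ?Gamma_gt0//.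
rewrite ler_ln ?posrE ?mulr_gt0 ?expR_gt0 ?Gamma_gt0//.
exact: Gamma_wendel.
Qed.

(** The upper bound is applied from x + h with increment 1 - h, which lands on x + 1. *)
Lemma lnGamma_ge x h : 0 < x -> 0 <= h <= 1 ->
  lnGamma x + ln x - (1 - h) * ln (x + h) <= lnGamma (x + h).
Proof.
move=> x0 h01; have /andP[h0 h1] := h01.
have xh : 0 < x + h by rewrite ltr_pwDl.
have k01 : 0 <= 1 - h <= 1 by apply/andP; split; lra.
have := lnGamma_le xh k01.
have -> : x + h + (1 - h) = x + 1 by ring.
by rewrite lnGammaS// lerBlDr.
Qed.

Lemma lnB_le x y : 0 < x -> 0 < y -> ln y - ln x <= (y - x) / x.
Proof.
move=> x0 y0; rewrite lerBlDl; apply: (le_trans (ln_le_div x0 y0)).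
by rewrite mulrBl divff ?gt_eqF.
Qed.

Lemma lnGamma_incr_pos x h : 0 < x -> 0 <= h <= 1 ->
  - (h / x) <= lnGamma (x + h) - lnGamma x - h * ln x <= 0.
Proof.
move=> x0 h01; have /andP[h0 h1] := h01.
have xh : 0 < x + h by rewrite ltr_pwDl.
have := lnGamma_le x0 h01; have := lnGamma_ge x0 h01.
have := lnB_le x0 xh; have -> : x + h - x = h by ring.
have lx : ln x <= ln (x + h) by rewrite ler_ln ?posrE// lerDl.
have := ler_wpM2l h0 lx.
move: (ln x) (ln (x + h)) (lnGamma x) (lnGamma (x + h)) (h / x) => p q r s t.
move=> a1 a2 a3 a4; apply/andP; split; lra.
Qed.

(** For h < 0 the base point becomes x + h, and ln(x+h) must be exchanged for ln x. Each of the two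
    errors is at most |h| / (x-1), because x + h >= x - 1. *)
Lemma lnGamma_incr x h : 1 < x -> `|h| <= 1 ->
  `|lnGamma (x + h) - lnGamma x - h * ln x| <= `|h| * (2 / (x - 1)).
Proof.
move=> x1 h1; have x0 : 0 < x by rewrite (lt_trans _ x1).
have y0 : 0 < x - 1 by rewrite subr_gt0.
have [h0|h0] := leP 0 h.
  rewrite ger0_norm// in h1.
  have h01 : 0 <= h <= 1 by rewrite h0.
  have /andP[a b] := lnGamma_incr_pos x0 h01.
  rewrite ler0_norm// lerNl (le_trans _ a)// lerN2 (ger0_norm h0).
  rewrite ler_wpM2l// ler_pdivlMr// mulrC ler_pdivrMr//.
  by clear -x1; lra.
rewrite ltr0_norm// in h1.
have k01 : 0 <= - h <= 1 by apply/andP; split; lra.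
have z0 : 0 < x + h by lra.
have k0 : 0 <= - h by lra.
have zx : x + h <= x by lra.
have yz : x - 1 <= x + h by lra.
have /andP[] := lnGamma_incr_pos z0 k01; rewrite addrK => a b.
have l0 : ln (x + h) <= ln x by rewrite ler_ln ?posrE.
have l1 := lnB_le z0 x0; have xz : x - (x + h) = - h by ring.
rewrite xz in l1.
have l2 : - h * (ln x - ln (x + h)) <= - h / (x + h).
  apply: le_trans (_ : 1 * (ln x - ln (x + h)) <= _); last by rewrite mul1r.
  by rewrite ler_wpM2r// subr_ge0.
have l3 : 0 <= - h * (ln x - ln (x + h)) by rewrite mulr_ge0// subr_ge0.
have l4 : - h / (x + h) <= - h / (x - 1).
  by rewrite ler_wpM2l// lef_pV2 ?posrE.
have -> : `|h| * (2 / (x - 1)) = - h / (x - 1) + - h / (x - 1).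
  by rewrite ltr0_norm//; ring.
rewrite ler_norml; move: a b l0 l2 l3 l4.
move: (ln x) (ln (x + h)) (lnGamma x) (lnGamma (x + h)) => p q r s.
move: (- h / (x + h)) (- h / (x - 1)) => t t' a b *.
by apply/andP; split; lra.
Qed.

Definition lnGamma_quot x h := h^-1 * (lnGamma (x + h) - lnGamma x).

Lemma lnGamma_quot_ln x : 1 < x ->
  \forall h \near (0:R)^', `|lnGamma_quot x h - ln x| <= 2 / (x - 1).
Proof.
move=> x1; near=> h.
have h0 : h != 0 by near: h; exact: nbhs_dnbhs_neq.
have h1 : `|h| <= 1 by near: h; apply: dnbhs0_le.
have -> : lnGamma_quot x h - ln x =
    h^-1 * (lnGamma (x + h) - lnGamma x - h * ln x).
  rewrite /lnGamma_quot mulrBr mulrBr mulrBr mulKf//.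
by rewrite normrM normfV ler_pdivrMl ?normr_gt0// lnGamma_incr.
Unshelve. all: end_near. Qed.

Lemma is_derive1_near (f : R -> R) x d : is_derive x 1 f d -> forall e, 0 < e ->
  \forall h \near (0:R)^', `|d - h^-1 * (f (x + h) - f x)| < e.
Proof.
move=> [df <-] e e0; have /cvgrPdist_lt/(_ e e0) := df.
apply: filterS => h; rewrite /= /GRing.scale/= mulr1 addrC [h + x]addrC.
by rewrite addrC.
Qed.

Lemma near_dnbhs0_gt0 x : 0 < x -> \forall h \near (0:R)^', 0 < x + h.
Proof.
move=> x0; near=> h.
have hx : `|h| < x by near: h; exact: dnbhs0_lt.
by move: hx; rewrite ltr_norml => /andP[+ _]; rewrite -subr_gt0 opprK addrC.
Unshelve. all: end_near. Qed.

(* The oscillation near 0 of the difference quotients at x is the same as at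
   x + 1, because the two differ by difference quotients of ln. *)
Lemma lnGamma_quot_near x e : 0 < x -> 0 < e ->
  exists c, \forall h \near (0:R)^', `|c - lnGamma_quot x h| < e.
Proof.
move=> x0 e0.
have [n] : exists n : nat, 2 < e * (x + n%:R - 1).
  exists (Num.truncn (2 / e + 1)).+1.
  rewrite mulrC -ltr_pdivrMr// ltrBrDr.
  by rewrite (lt_trans (truncnS_gt _))// ltrDr.
elim: n x x0 e e0 => [|n IH] x x0 e e0.
  rewrite addr0 => xe; exists (ln x).
  have y0 : 0 < x - 1.
    by rewrite -(pmulr_rgt0 _ e0) (lt_trans _ xe).
  have x1 : 1 < x by rewrite -subr_gt0.
  near=> h; rewrite distrC; apply: (@le_lt_trans _ _ (2 / (x - 1))).
    by near: h; exact: lnGamma_quot_ln.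
  by rewrite ltr_pdivrMr.
rewrite -[n.+1%:R]natr1 (addrC n%:R) addrA => xn.
have x1 : 0 < x + 1 by rewrite addr_gt0.
set m := x + 1 + n%:R - 1 in xn.
have m0 : 0 < m by rewrite -(pmulr_rgt0 _ e0) (lt_trans _ xn).
have me : 2 / m < e by rewrite ltr_pdivrMr.
(* The induction hypothesis is used with [e'] strictly between 2/m and e, leaving the margin e - e'
   for the difference quotients of [ln]. *)
have [e' [e'0 me' e'e]] : exists e', [/\ 0 < e', 2 < e' * m & e' < e].
  exists ((2 / m + e) / 2); split.
  - by rewrite divr_gt0// addr_gt0// divr_gt0.
  - by rewrite -ltr_pdivrMr// midf_lt.
  - by rewrite midf_lt.
have [c Hc] := IH _ x1 _ e'0 me'.
have ee : 0 < e - e' by rewrite subr_gt0.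
exists (c - x^-1); near=> h.
have h1 : `|c - lnGamma_quot (x + 1) h| < e' by near: h; exact: Hc.
have h2 : `|x^-1 - h^-1 * (ln (x + h) - ln x)| < e - e'.
  by near: h; apply: is_derive1_near => //; exact: is_derive1_ln.
have xh : 0 < x + h by near: h; exact: near_dnbhs0_gt0.
have -> : lnGamma_quot x h =
    lnGamma_quot (x + 1) h - h^-1 * (ln (x + h) - ln x).
  rewrite /lnGamma_quot addrAC !lnGammaS// -mulrBr; congr (_ * _).
  by rewrite opprD addrACA addrK.
rewrite (_ : c - x^-1 - _ = (c - lnGamma_quot (x + 1) h) -
  (x^-1 - h^-1 * (ln (x + h) - ln x))); last first.
  by rewrite !opprB addrACA [- x^-1 + _]addrC addrACA.
apply: le_lt_trans (ler_normB _ _) _.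
by rewrite -[e](subrK e') [ltRHS]addrC ltrD.
Unshelve. all: end_near. Qed.

(** The difference quotients eventually enter some ball of every radius, so they form a Cauchy
    filter; completeness gives a limit without identifying it. *)
Lemma derivable_lnGamma x : 0 < x -> derivable lnGamma x 1.
Proof.
move=> x0; apply: cauchy_cvg; apply: cauchy_exP => e e0.
have [c Hc] := lnGamma_quot_near x0 e0; exists c.
move: Hc; apply: filterS => h; rewrite /ball/= /lnGamma_quot /GRing.scale/=.
by rewrite mulr1 [h + x]addrC.
Qed.

(** Near x, Gamma is the exponential of [lnGamma], hence differentiable; this makes the derivative
    inside [digamma] a genuine one. *)
Lemma is_derive_lnGamma x : 0 < x -> is_derive x 1 lnGamma (digamma x).
Proof.
move=> x0; have G0 := Gamma_gt0 x0.
have dl : is_derive x 1 lnGamma ('D_1 lnGamma x).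
  by apply: DeriveDef => //; exact: derivable_lnGamma.
have dG : is_derive x 1 (@Gamma R) (Gamma x * 'D_1 lnGamma x).
  rewrite -(expR_lnGamma x0).
  apply: near_eq_is_derive (is_derive_expR_comp dl); near=> y.
  rewrite expR_lnGamma//.
  by near: y; exact: lt_nbhsr.
have -> : digamma x = 'D_1 lnGamma x; last by [].
rewrite /digamma derive1E; have [_ ->] := dG.
by rewrite mulrC mulKf// gt_eqF.
Unshelve. all: end_near. Qed.

Lemma digammaS x : 0 < x -> digamma (x + 1) = digamma x + x^-1.
Proof.
move=> x0; have x1 : 0 < x + 1 by rewrite addr_gt0.
have d1 : is_derive x 1 (fun y => lnGamma (y + 1)) (digamma (x + 1)).
  have ds : is_derive x 1 (fun y : R => y + 1) 1.
    by apply: is_derive_eq; rewrite addr0.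
  have dl := is_derive_lnGamma x1.
  have := @is_derive1_comp R lnGamma (fun y => y + 1) x _ _ dl ds.
  by rewrite mulr1.
have dl := is_derive_lnGamma x0; have dln := is_derive1_ln x0.
have d2 : is_derive x 1 (fun y => lnGamma y + ln y) (digamma x + x^-1).
  exact: is_derive_eq.
have d3 : is_derive x 1 (fun y => lnGamma (y + 1)) (digamma x + x^-1).
  apply: near_eq_is_derive d2; near=> y; rewrite lnGammaS//.
  by near: y; exact: lt_nbhsr.
by have [_ <-] := d1; have [_ <-] := d3.
Unshelve. all: end_near. Qed.

(** The bound on the difference quotients passes to their limit. *)
Lemma digamma_ln x : 1 < x -> `|digamma x - ln x| <= 2 / (x - 1).
Proof.
move=> x1; have x0 : 0 < x by rewrite (lt_trans _ x1).
rewrite leNgt; apply/negP => H.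
have e0 : 0 < `|digamma x - ln x| - 2 / (x - 1) by rewrite subr_gt0.
near (0:R)^' => h.
have h1 : `|lnGamma_quot x h - ln x| <= 2 / (x - 1).
  by near: h; exact: lnGamma_quot_ln.
have h2 : `|digamma x - lnGamma_quot x h| < `|digamma x - ln x| - 2 / (x - 1).
  by near: h; apply: is_derive1_near => //; exact: is_derive_lnGamma.
have := ler_distD (lnGamma_quot x h) (digamma x) (ln x).
rewrite leNgt => /negP; apply.
by rewrite -[ltRHS](subrK (2 / (x - 1))) ltr_leD.
Unshelve. all: end_near. Qed.

(* The values at the translates x + n decrease to 0. *)
Lemma gt0_shift_decreasing (f : R -> R) c x : 0 <= c -> 0 < x ->
  (forall y, 0 < y -> f (y + 1) < f y) ->
  (forall y, 1 < y -> `|f y| <= c / (y - 1)) -> 0 < f x.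
Proof.
move=> c0 x0 df bf.
have fS n y : 0 < y -> f (y + n%:R) <= f y.
  elim: n y => [|n IH] y y0; first by rewrite addr0.
  rewrite -[n.+1%:R]natr1 (addrC n%:R) addrA (le_trans (IH _ _))//.
    by rewrite addr_gt0.
  exact/ltW/df.
have x1 : 0 < x + 1 by rewrite addr_gt0.
(* The first shift is already strict, so f(x+1) >= 0 suffices. A negative value there would persist
   along the translates, against the bound c/n for large n. *)
apply: le_lt_trans (df x x0); rewrite leNgt; apply/negP => u0.
pose n := (Num.truncn (c / - f (x + 1))).+1.
have n0 : 0 < n%:R :> R by rewrite ltr0n.
have : c < - f (x + 1) * n%:R.
  by rewrite mulrC -ltr_pdivrMr ?oppr_gt0// truncnS_gt.
rewrite -ltr_pdivrMr//; apply/negP; rewrite -leNgt.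
have xn : 1 < x + 1 + n%:R by rewrite addrAC ltrDr addr_gt0.
have := bf _ xn; rewrite addrAC addrK => b.
apply: (le_trans (_ : _ <= c / (x + n%:R))); last first.
  by rewrite ler_wpM2l// lef_pV2 ?posrE ?addr_gt0// lerDr ltW.
apply: (le_trans _ b); rewrite ler_normr; apply/orP; right.
by rewrite lerN2 addrAC fS.
Qed.

End digamma_properties.

(** * Elementary inequalities for the logarithm *)

Section elementary_inequalities.
Variable R : realType.
Implicit Types (x y s t a b : R).

Lemma is_derive1_continuous (f : R -> R) x (d : R) :
  is_derive x 1 f d -> {for x, continuous f}.
Proof.
move=> [df _]; apply: differentiable_continuous; exact/derivable1_diffP.
Qed.

Lemma gt0_derive_lt (f f' : R -> R) a b : a < b ->
  (forall y, a <= y -> is_derive y 1 f (f' y)) ->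
  (forall y, a < y -> 0 < f' y) -> f a < f b.
Proof.
move=> ab df f'0.
have [||c /[!in_itv]/= /andP[ac cb] E] := @MVT R f f' a b ab.
- by move=> y; rewrite in_itv/= => /andP[/ltW/df].
- apply: continuous_in_subspaceT => y; rewrite inE/= in_itv/= => /andP[ay _].
  exact: is_derive1_continuous (df _ ay).
by rewrite -subr_gt0 E mulr_gt0 ?f'0// subr_gt0.
Qed.

Lemma is_derive_addl a y : is_derive y 1 (fun t => a + t) 1.
Proof. by apply: is_derive_eq; rewrite add0r mulr1. Qed.

Lemma is_derive_ln_shift a y : 0 < a + y ->
  is_derive y 1 (fun t => ln (a + t)) (a + y)^-1.
Proof.
by move=> h; have := is_derive_ln_comp h (is_derive_addl a y); rewrite mulr1.
Qed.

Lemma is_derive_inv_shift a y : 0 < a + y ->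
  is_derive y 1 (fun t => (a + t)^-1) (- (a + y) ^- 2).
Proof.
move=> h; have n0 : a + y != 0 by rewrite gt_eqF.
have := @is_deriveV R (fun t => a + t) y 1 1 n0 (is_derive_addl a y).
by rewrite /GRing.scale/= mulr1.
Qed.

(** With t = 1/x this is g > 1/(2x + 2/3). The auxiliary [f] is the difference of the two sides, up
    to a constant, the rational one being split into partial fractions. *)
Lemma ln1D_gt t : 0 < t ->
  t * (6 + 5 * t) / ((1 + t) * (6 + 2 * t)) < ln (1 + t).
Proof.
move=> t0.
pose f y : R := ln (1 + y) + (4^-1 * (1 + y)^-1 + 27 / 4 * (3 + y)^-1).
pose f' y : R := y ^+ 3 / ((1 + y) ^+ 2 * (3 + y) ^+ 2).
have : f 0 < f t.
  apply: (@gt0_derive_lt f f' 0 t t0) => y y0; last first.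
    by rewrite divr_gt0 ?mulr_gt0 ?exprn_gt0// addr_gt0.
  have y1 : 0 < 1 + y by rewrite ltr_pwDl.
  have y3 : 0 < 3 + y by rewrite ltr_pwDl.
  have d1 := is_derive_ln_shift y1.
  have d2 := is_derive_inv_shift y1.
  have d3 := is_derive_inv_shift y3.
  apply: is_derive_eq; rewrite /f' /GRing.scale/=; field.
  by rewrite !gt_eqF.
rewrite /f !addr0 ln1 add0r -ltrBlDr; apply: le_lt_trans.
rewrite le_eqVlt; apply/orP; left; apply/eqP; field.
by rewrite !gt_eqF//; lra.
Qed.

(** With t = 1/x this is g < 1/(2x). Dividing by 1 + t isolates the logarithm, and the difference
    then has derivative half of (t/(1+t))^2. *)
Lemma ln1D_lt t : 0 < t -> (1 + t) * ln (1 + t) < t + t ^+ 2 / 2.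
Proof.
move=> t0.
pose f y : R := y - (2 * ln (1 + y) + (1 + y)^-1).
pose f' y : R := (y / (1 + y)) ^+ 2.
have t1 : 0 < 1 + t by rewrite addr_gt0.
have : f 0 < f t.
  apply: (@gt0_derive_lt f f' 0 t t0) => y y0; last first.
    by rewrite exprn_gt0// divr_gt0// addr_gt0.
  have y1 : 0 < 1 + y by rewrite ltr_pwDl.
  have d1 := is_derive_ln_shift y1.
  have d2 := is_derive_inv_shift y1.
  apply: is_derive_eq; rewrite /f' /GRing.scale/=; field.
  by rewrite !gt_eqF.
rewrite /f !addr0 ln1 mulr0 add0r invr1 => h.
have : ln (1 + t) < (t + t ^+ 2 / 2) / (1 + t).
  have -> : (t + t ^+ 2 / 2) / (1 + t) = (t - (1 + t)^-1 + 1) / 2.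
    by field; rewrite gt_eqF.
  move: h; move: (ln _) => L; move: (_^-1) => i; clear; lra.
by rewrite ltr_pdivlMr// mulrC.
Qed.

(** Both sides vanish at s = 3, which corresponds to x = +oo under (s^2 - 1)/8 = 1 + 1/x. The
    derivative of their difference factors with a cube of s - 3. *)
Lemma ln_sqr_lt s : 3 < s ->
  ln ((s ^+ 2 - 1) / 8) < (s + 5) * (s ^+ 2 - 9) / (4 * (s + 1) ^+ 2).
Proof.
move=> s3.
pose f y : R := 4^-1 * y - (4 * (1 + y)^-1 + 8 * ((1 + y)^-1 * (1 + y)^-1)
   + (ln (-1 + y) + ln (1 + y))).
pose f' y : R := (y - 3) ^+ 3 * (y + 3) / (4 * (y - 1) * (y + 1) ^+ 3).
have : f 3 < f s.
  apply: (@gt0_derive_lt f f' 3 s s3) => y y0; last first.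
    have a1 : 0 < y - 3 by rewrite subr_gt0.
    have a2 : 0 < y + 3 by rewrite addr_gt0// (lt_trans _ y0).
    have a3 : 0 < y - 1 by rewrite subr_gt0 (lt_trans _ y0)// ltr1n.
    have a4 : 0 < y + 1 by rewrite addr_gt0// (lt_trans _ y0).
    rewrite divr_gt0//; first by rewrite mulr_gt0// exprn_gt0.
    apply: mulr_gt0; last exact: exprn_gt0.
    by rewrite mulr_gt0.
  have y1 : 0 < 1 + y by lra.
  have y2 : 0 < -1 + y by lra.
  have d1 := is_derive_ln_shift y1.
  have d2 := is_derive_inv_shift y1.
  have d3 := is_derive_ln_shift y2.
  apply: is_derive_eq; rewrite /f' /GRing.scale/=; field.
  by rewrite addrC gt_eqF//= addrC gt_eqF.
have s1 : 0 < -1 + s by lra.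
have s2 : 0 < 1 + s by lra.
have -> : (s ^+ 2 - 1) / 8 = (-1 + s) * (1 + s) / 8 by field.
rewrite ln_div ?posrE ?mulr_gt0// lnM ?posrE//.
have -> : 8 = (-1 + 3) * (1 + 3) :> R by ring.
rewrite lnM ?posrE//; try lra.
rewrite /f; move: (ln _) (ln _) (ln _) (ln _) => p q r w.
have -> : (s + 5) * (s ^+ 2 - 9) / (4 * (s + 1) ^+ 2) =
  s / 4 + 3 / 4 - 4 * (1 + s)^-1 - 8 * ((1 + s)^-1 * (1 + s)^-1).
  by field; rewrite gt_eqF//; lra.
have -> : (1 + 3)^-1 = 1 / 4 :> R by field.
move: ((1 + s)^-1 * (1 + s)^-1) ((1 + s)^-1) => j i; clear; lra.
Qed.

End elementary_inequalities.

(** * Bounds and growth of [delta_upper] *)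

Section delta_upper_properties.
Variable R : realType.
Implicit Types (x y L : R).

(** The function g of the overview, with ln(1 + 1/x) split into two logarithms. *)
Definition ln_excess x := (1 + x) * (ln (1 + x) - ln x) - 1.

Lemma ln1DV x : 0 < x -> ln (1 + x^-1) = ln (1 + x) - ln x.
Proof.
move=> x0; rewrite -ln_div ?posrE ?addr_gt0//; congr ln.
by field; rewrite gt_eqF.
Qed.

Lemma delta_upperE x : 0 < x -> delta_upper x = (2 * ln_excess x)^-1.
Proof.
move=> x0; rewrite /delta_upper /ln_excess !mul1r ln1DV// (addrC x 1).
by rewrite invfM.
Qed.

(** The expansion g = 1/(2x) - 1/(6x^2) + ... agrees with that of 1/(2x + 2/3) to this order; this
    is the origin of the shift 1/3. *)
Lemma ln_excess_gt x : 0 < x -> (2 * x + 2 / 3)^-1 < ln_excess x.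
Proof.
move=> x0; have t0 : 0 < x^-1 by rewrite invr_gt0.
have x1 : 0 < 1 + x by rewrite addr_gt0.
have := ln1D_gt t0; rewrite ln1DV// /ln_excess.
move: (ln _ - ln _) => L; rewrite ltrBrDr -(ltr_pM2l x1).
apply: le_lt_trans; rewrite le_eqVlt; apply/orP; left; apply/eqP; field.
by rewrite !gt_eqF//; clear -x0; lra.
Qed.

Lemma ln_excess_lt x : 0 < x -> ln_excess x < (2 * x)^-1.
Proof.
move=> x0; have t0 : 0 < x^-1 by rewrite invr_gt0.
have := ln1D_lt t0; rewrite ln1DV// /ln_excess.
move: (ln _ - ln _) => L h; rewrite -(ltr_pM2l x0) in h; rewrite ltrBlDr.
have -> : (1 + x) * L = x * ((1 + x^-1) * L) by field; rewrite gt_eqF.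
apply: (lt_le_trans h).
by rewrite le_eqVlt; apply/orP; left; apply/eqP; field; rewrite gt_eqF.
Qed.

Lemma ln_excess_gt0 x : 0 < x -> 0 < ln_excess x.
Proof.
move=> x0; apply: lt_trans (ln_excess_gt x0).
by rewrite invr_gt0 addr_gt0// mulr_gt0.
Qed.

Lemma delta_upper_bounds x : 0 < x -> x < delta_upper x < x + 3^-1.
Proof.
move=> x0; rewrite delta_upperE//.
have := ln_excess_gt x0; have := ln_excess_lt x0; have := ln_excess_gt0 x0.
move: (ln_excess x) => g g0 g1 g2; rewrite invfM.
have x2 : 0 < 2 * x by rewrite mulr_gt0.
have x3 : 0 < 2 * x + 2 / 3 by rewrite addr_gt0.
have h1 : 2 * x < g^-1 by rewrite -[ltLHS]invrK ltf_pV2 ?posrE ?invr_gt0.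
have h2 : g^-1 < 2 * x + 2 / 3 by rewrite -[ltRHS]invrK ltf_pV2 ?posrE ?invr_gt0.
move: h1 h2; move: (g^-1) => i; clear => h1 h2; apply/andP; split; lra.
Qed.

(* With s = sqrt (9 + 8 / x), the claim is a quadratic inequality in the
   logarithm whose larger root is the right-hand side of ln_sqr_lt. *)
Lemma ln_excess_sqr_lt x : 0 < x ->
  2 * ln_excess x ^+ 2 < x^-1 - (ln (1 + x) - ln x).
Proof.
move=> x0; pose s := Num.sqrt (9 + 8 / x).
have s2 : s ^+ 2 = 9 + 8 / x by rewrite sqr_sqrtr// ltW// addr_gt0// divr_gt0.
have s3 : 3 < s.
  rewrite -(ger0_norm (ler0n R 3)) -sqrtr_sqr ltr_sqrt; last first.
    by rewrite addr_gt0// divr_gt0.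
  rewrite (_ : 3 ^+ 2 = 9); last by ring.
  by rewrite ltrDl divr_gt0.
have := ln_sqr_lt s3; have := ln_excess_gt0 x0.
have -> : (s ^+ 2 - 1) / 8 = 1 + x^-1.
  by rewrite s2; field; rewrite gt_eqF.
rewrite ln1DV// /ln_excess; move: (ln _ - ln _) => L.
have z0 : 0 < s ^+ 2 - 9 by rewrite s2 addrC addKr divr_gt0.
have xE : x = 8 / (s ^+ 2 - 9).
  by rewrite s2 [_ - 9]addrC addKr invf_div mulrC divfK.
have s1 : 0 < s + 1 by clear -s3; lra.
set B := _ / (4 * _); move=> L0 LB.
(* The smaller root of 2(1+x)^2 L^2 - (4x+3) L + 2 - 1/x, whose discriminant is s^2. It lies below L
   because A < 1/(1+x) < L. *)
pose A := (4 * x + 3 - s) / (4 * (1 + x) ^+ 2).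
have x1 : 0 < 1 + x by rewrite addr_gt0.
have AL : A < L.
  rewrite subr_gt0 mulrC -ltr_pdivrMr// in L0; apply: lt_trans L0.
  have -> : A = (4 * x + 3 - s) / (4 * (1 + x)) * (1 + x)^-1.
    by rewrite /A; field; rewrite gt_eqF.
  rewrite ltr_pM2r ?invr_gt0// ltr_pdivrMr ?mulr_gt0//.
  by clear -s3; lra.
have E : 2 * ((1 + x) * L - 1) ^+ 2 - (x^-1 - L) =
    2 * (1 + x) ^+ 2 * ((L - A) * (L - B)).
  have sm : s - 1 != 0 by rewrite subr_eq0 gt_eqF//; clear -s3; lra.
  have zn : s ^+ 2 - 9 != 0 by rewrite gt_eqF.
  have sp : s + 1 != 0 by rewrite gt_eqF.
  move: sm zn sp; rewrite /A /B xE; clear => sm zn sp; field.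
  rewrite zn sp /=.
  have -> : s ^+ 2 - 9 + 8 = (s - 1) * (s + 1) by ring.
  by rewrite mulf_neq0.
rewrite -subr_lt0 E pmulr_rlt0 ?mulr_gt0 ?exprn_gt0//.
by rewrite pmulr_rlt0 ?subr_gt0// subr_lt0.
Qed.

Lemma is_derive_ln_excess x : 0 < x ->
  is_derive x 1 ln_excess (ln (1 + x) - ln x - x^-1).
Proof.
move=> x0; have x1 : 0 < 1 + x by rewrite addr_gt0.
have d1 := is_derive_ln_shift x1.
have d2 := is_derive1_ln x0.
have d3 := is_derive_addl 1 x.
have d4 : is_derive x 1 (fun t => ln (1 + t) - ln t) ((1 + x)^-1 - x^-1).
  exact: is_derive_eq.
have d5 := is_deriveM d3 d4.
have d6 : is_derive x 1 (fun t => (1 + t) * (ln (1 + t) - ln t) - 1)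
    ((1 + x) * ((1 + x)^-1 - x^-1) + (ln (1 + x) - ln x) * 1 - 0).
  exact: is_derive_eq.
apply: (is_derive_eq d6).
move: (ln _ - ln _) => L; field.
by rewrite !gt_eqF.
Qed.

(** The function d(y) - y has derivative -g'/(2g^2) - 1, which is positive by [ln_excess_sqr_lt]. *)
Lemma delta_upperS x : 0 < x -> delta_upper x + 1 < delta_upper (x + 1).
Proof.
move=> x0; have x1 : 0 < x + 1 by rewrite addr_gt0.
pose f y := (2 * ln_excess y)^-1 - y.
pose f' y := - (2 * ln_excess y) ^- 2 * (2 * (ln (1 + y) - ln y - y^-1)) - 1.
have xx : x < x + 1 by rewrite ltrDl.
have : f x < f (x + 1).
  apply: (@gt0_derive_lt _ f f' _ _ xx) => y xy; last first.
    have y0 : 0 < y by exact: lt_trans xy.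
    have := ln_excess_sqr_lt y0; have := ln_excess_gt0 y0.
    rewrite /f'; move: (ln_excess y) (ln _ - ln _) => g L g0.
    move=> h; rewrite subr_gt0 mulNr -mulrN.
    have g2 : 0 < (2 * g) ^+ 2 by rewrite exprn_gt0// mulr_gt0.
    rewrite mulrC ltr_pdivlMr// mul1r.
    move: h; move: (y^-1) => i; clear; rewrite exprMn; lra.
  have y0 : 0 < y by exact: lt_le_trans xy.
  have d1 := is_derive_ln_excess y0.
  have n0 : 2 * ln_excess y != 0.
    by rewrite gt_eqF// mulr_gt0// ln_excess_gt0.
  have d2 : is_derive y 1 (fun t => 2 * ln_excess t)
      (2 * (ln (1 + y) - ln y - y^-1)).
    exact: is_derive_eq.
  have d3 := @is_deriveV R (fun t => 2 * ln_excess t) _ _ _ n0 d2.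
  have d4 := @is_derive_id R R y 1.
  exact: (is_deriveB d3 d4).
rewrite /f !delta_upperE//.
by rewrite ltrBlDr opprD addrA addrAC subrK ltrBrDr.
Qed.

End delta_upper_properties.

(** * Monotonicity of digamma and Stirling's formula *)

Section stirling.
Variable R : realType.
Implicit Types (x y z t : R) (n : nat).

(** For fixed d > 0, psi(t+d) - psi(t) drops by 1/t - 1/(t+d) when t grows by 1, and it is O(1/t).
    In the constant, 4 pays for two uses of [digamma_ln] and d for ln(t+d) - ln t. *)
Lemma digamma_lt x y : 0 < x -> x < y -> digamma x < digamma y.
Proof.
move=> x0 xy; pose d := y - x; have d0 : 0 < d by rewrite subr_gt0.
pose f t := digamma (t + d) - digamma t.
suff : 0 < f x by rewrite /f [x + d]addrC subrK subr_gt0.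
apply: (@gt0_shift_decreasing _ f (4 + d)) => // [|t t0|t t1].
- by rewrite addr_ge0// ltW.
- have td : 0 < t + d by rewrite addr_gt0.
  rewrite /f addrAC !digammaS// opprD addrACA gtrDl subr_lt0.
  by rewrite ltf_pV2 ?posrE// ltrDl.
have t0 : 0 < t by rewrite (lt_trans _ t1).
have td : 1 < t + d by rewrite (lt_trans t1)// ltrDl.
have td0 : 0 < t + d by rewrite addr_gt0.
have t10 : 0 < t - 1 by rewrite subr_gt0.
have h1 : `|digamma (t + d) - ln (t + d)| <= 2 / (t - 1).
  apply: le_trans (digamma_ln td) _.
  by rewrite ler_pM2l// lef_pV2 ?posrE ?subr_gt0// lerD2r lerDl ltW.
have h2 := digamma_ln t1.
have h3 : ln (t + d) - ln t <= d / (t - 1).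
  apply: le_trans (lnB_le t0 td0) _; rewrite addrC addKr.
  by rewrite ler_pM2l// lef_pV2 ?posrE// gerBl.
have h4 : 0 <= ln (t + d) - ln t by rewrite subr_ge0 ler_ln ?posrE// lerDl ltW.
rewrite /f; move: h1 h2 h3 h4.
have -> : (4 + d) / (t - 1) = 2 / (t - 1) + 2 / (t - 1) + d / (t - 1) by ring.
rewrite !ler_norml.
move: (2 / _) (d / _) (ln _) (ln _) (digamma _) (digamma _) => a b p q r s.
clear => /andP[? ?] /andP[? ?] ? ?; apply/andP; split; lra.
Qed.

(** The logarithm of Gamma(y) divided by its Stirling approximation; f in the overview is this minus
    ln(y)/2. *)
Definition stirling_log y :=
  lnGamma y - (y - 1 / 2) * ln y + y - ln (2 * pi) / 2.

Lemma stirling_logS y : 0 < y -> stirling_log y - stirling_log (y + 1) =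
  (y + 1 / 2) * (ln (1 + y) - ln y) - 1.
Proof.
move=> y0; rewrite /stirling_log lnGammaS// (addrC y 1).
move: (lnGamma y) (ln (1 + y)) (ln y) (ln (2 * pi)) => a b c d.
by field.
Qed.

(** The bounds on g are rescaled by (y + 1/2)/(y + 1). The upper bound 1/(4y(y+1)) is kept as a
    difference so that it telescopes. *)
Lemma stirling_logS_bounds y : 0 < y ->
  0 <= stirling_log y - stirling_log (y + 1) <= (y^-1 - (y + 1)^-1) / 4.
Proof.
move=> y0; rewrite stirling_logS//.
have y1 : 0 < 1 + y by rewrite addr_gt0.
have := ln_excess_gt y0; have := ln_excess_lt y0; rewrite /ln_excess.
move: (ln _ - ln _) => L h1 h2.
have c0 : 0 < (y + 1 / 2) / (1 + y) by rewrite divr_gt0// addr_gt0.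
have -> : (y + 1 / 2) * L - 1 =
    (y + 1 / 2) / (1 + y) * ((1 + y) * L - 1) - (1 / 2) / (1 + y).
  by field; rewrite gt_eqF.
move: h1 h2; rewrite -(ltr_pM2l c0) => h1; rewrite -(ltr_pM2l c0) => h2.
apply/andP; split.
  rewrite subr_ge0; apply: le_trans (ltW h2).
  rewrite ler_pdivrMr//.
  have -> : (y + 1 / 2) / (1 + y) / (2 * y + 2 / 3) * (1 + y) =
      (y + 1 / 2) / (2 * y + 2 / 3).
    by field; rewrite !gt_eqF//; clear -y0; lra.
  rewrite ler_pdivlMr; clear -y0; lra.
rewrite lerBlDr; apply: le_trans (ltW h1) _.
rewrite le_eqVlt; apply/orP; left; apply/eqP; field.
by rewrite !gt_eqF// addrC.
Qed.

Lemma stirling_log_addn y n : 0 < y ->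
  0 <= stirling_log y - stirling_log (y + n%:R) <= (y^-1 - (y + n%:R)^-1) / 4.
Proof.
move=> y0; elim: n => [|n /andP[IH1 IH2]].
  by rewrite addr0 !subrr mul0r lexx.
have yn : 0 < y + n%:R by rewrite ltr_pwDl.
have /andP[] := stirling_logS_bounds yn; rewrite -[y + _ + 1]addrA natr1.
move: IH1 IH2; move: (stirling_log _) (stirling_log _) (stirling_log _).
move: (y^-1) (_^-1) (_^-1) => a b c p q r; clear => *.
apply/andP; split; lra.
Qed.

(** Passing from m to m + 1 multiplies both sides of the duplication formula by m (m + 1/2), so the
    functional equation suffices; the case m = 1 rests on Gamma(1/2). *)
Lemma legendre_lnGamma n : lnGamma n.+1%:R + lnGamma (n.+1%:R + 1 / 2) =
  (1 - 2 * n.+1%:R) * ln 2 + ln pi / 2 + lnGamma (2 * n.+1%:R) :> R.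
Proof.
have l1 : lnGamma 1 = 0 :> R by rewrite /lnGamma Gamma1 ln1.
have p0 := pi_gt0 R.
elim: n => [|n IH].
  have l2 : lnGamma 2 = 0 :> R.
    by have := lnGammaS (@ltr01 R); rewrite l1 ln1 addr0.
  have l3 : lnGamma (1 + 1 / 2) = lnGamma (1 / 2) + ln (1 / 2) :> R.
    by rewrite addrC lnGammaS// divr_gt0.
  rewrite mulr1 l1 l2 l3 /lnGamma Gamma_half ln_div ?posrE// ln1.
  have -> : ln (Num.sqrt pi) = ln pi / 2 :> R.
    rewrite -[in RHS](sqr_sqrtr (ltW p0)) lnXn ?sqrtr_gt0//.
    by move: (ln _) => L; clear; field.
  by move: (ln _) (ln _) => a b; clear; lra.
have n0 : 0 < n.+1%:R :> R by rewrite ltr0n.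
rewrite -[n.+2%:R]natr1; move: (n.+1%:R) n0 IH => {n} y y0 IH.
have y2 : 0 < y + 1 / 2 by rewrite addr_gt0// divr_gt0.
have y3 : 0 < 2 * y by rewrite mulr_gt0.
have y4 : 0 < 2 * y + 1 by rewrite addr_gt0.
have e1 : 2 * (y + 1) = 2 * y + 1 + 1 by ring.
have e2 : 2 * y + 1 = 2 * (y + 1 / 2) by field.
have e3 : ln (2 * y) = ln 2 + ln y by rewrite lnM ?posrE.
have e4 : ln (2 * y + 1) = ln 2 + ln (y + 1 / 2) by rewrite e2 lnM ?posrE.
rewrite addrAC (lnGammaS y0) (lnGammaS y2) e1 (lnGammaS y4) (lnGammaS y3) e3 e4.
move: IH; move: (lnGamma _) (lnGamma _) (lnGamma _) => p q r.
move: (ln _) (ln y) (ln (pi : R)) (ln 2) => a b c d; clear => ?; lra.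
Qed.

(* Legendre's duplication formula makes 2 S(n) - S(2n) a difference of
   consecutive half-integer values of ln Gamma; it fixes the constant. *)
Lemma stirling_log_nat n :
  `|stirling_log n.+1%:R| <= 1 / 2 / n.+1%:R :> R.
Proof.
have n0 : 0 < n.+1%:R :> R by rewrite ltr0n.
have /andP[h1 h2] := stirling_log_addn n.+1 n0.
have h01 : 0 <= 1 / 2 :> R by rewrite divr_ge0.
have h02 : 1 / 2 <= 1 :> R by rewrite ler_pdivrMr // mul1r ler1n.
have /andP[h3 h4] := lnGamma_incr_pos n0 (introT andP (conj h01 h02)).
have := legendre_lnGamma n.
move: h1 h2 h3 h4; move: (n.+1%:R) n0 => y y0.
have -> : y + y = 2 * y by ring.
(* With the duplication formula the right-hand side becomes lnGamma(y) - lnGamma(y + 1/2) + ln(y)/2,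
   which lies in [0, 1/(2y)]. Subtracting S(y) - S(2y), which lies in [0, 1/(8y)], isolates S(y). *)
have E : 2 * stirling_log y - stirling_log (2 * y) =
    2 * lnGamma y - lnGamma (2 * y) - (2 * y - 1) * ln y +
    (2 * y - 1 / 2) * (ln 2 + ln y) - (ln 2 + ln pi) / 2.
  rewrite /stirling_log !lnM ?posrE ?pi_gt0//.
  move: (lnGamma _) (lnGamma _) (ln _) (ln _) (ln _) => a b c d e.
  by field.
rewrite invfM; move: E; move: (stirling_log _) (stirling_log _) => s s2.
move: (lnGamma _) (lnGamma _) (lnGamma _) (ln _) (ln _) (ln _) => a b c d e f.
rewrite -[1 / 2 / y]mulrA; move: (y^-1) => i; rewrite -div1r.
move=> E h1 h2 h3 h4 L; rewrite ler_norml; apply/andP; split; lra.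
Qed.

(** The integer m with m <= y < m + 1 carries the estimate over: lnGamma(y) is lnGamma(m) + (y-m) ln
    m up to (y-m)/m, and 1/m <= 1/(y-1). *)
Lemma stirling_log_le y : 1 < y -> `|stirling_log y| <= 2 / (y - 1).
Proof.
move=> y1; have y0 : 0 < y by rewrite (lt_trans _ y1).
have [n /andP[ny yn]] : exists n, n.+1%:R <= y < n.+1%:R + 1.
  have t1 : (0 < Num.truncn y)%N by rewrite truncn_gt0 ltW.
  exists (Num.truncn y).-1.
  by rewrite prednK// truncn_le (ltW y0) natr1 truncnS_gt.
have n0 : 0 < n.+1%:R :> R by rewrite ltr0n.
have t01 : 0 <= y - n.+1%:R <= 1 by rewrite subr_ge0 ny lerBlDl ltW.
have := lnGamma_incr_pos n0 t01.
have := stirling_log_nat n; rewrite /stirling_log.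
have := lnB_le y0 n0; have := lnB_le n0 y0.
move: (n.+1%:R) n0 ny yn t01 => m m0 my ym /andP[t0 t1].
have -> : m + (y - m) = y by rewrite addrC subrK.
have -> : (m - y) / y = - ((y - m) / y) by ring.
set q := (y - m) / m; set r := (y - m) / y.
have rE : r * y = y - m by rewrite divfK ?gt_eqF.
have qE : q * m = y - m by rewrite divfK ?gt_eqF.
have i1 : 2 / m <= 2 / (y - 1).
  by rewrite ler_pM2l// lef_pV2 ?posrE ?subr_gt0// lerBlDr ltW.
have r0 : 0 <= r by rewrite divr_ge0// ltW.
have q0 : 0 <= q by rewrite divr_ge0// ltW.
have q1 : q <= m^-1 by rewrite ler_pdivrMr// mulVf ?gt_eqF.
have rq : r <= q by rewrite ler_wpM2l// lef_pV2 ?posrE.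
have tq : (y - m) * q <= q by rewrite ler_piMl.
move: (ln _) (ln m) (ln y) (lnGamma m) (lnGamma y) => c lm ly gm gy.
move=> h1 h2.
have y20 : 0 <= y - 1 / 2 by clear -y1; lra.
have := ler_wpM2l y20 h1; have := ler_wpM2l y20 h2.
(* The main term q m = y - m cancels against the linear terms of the two Stirling logarithms; the
   rest is O(1/m). *)
have -> : (y - 1 / 2) * q = q * m + (y - m) * q - q / 2 by field.
have -> : (y - 1 / 2) * - r = - (r * y - r / 2) by field.
rewrite rE qE -[1 / 2 / m]mulrA.
move=> h3 h4; rewrite ler_norml => /andP[h5 h6] /andP[h7 h8].
rewrite ler_norml; move: i1 q1 tq h5 h6; move: (2 / (y - 1)) (m^-1) => i' i.
move: h3 h4 h7 h8; rewrite !mulrBr !mulrBl.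
clear -rq r0 q0; move=> *; apply/andP; split; lra.
Qed.

(** * Comparison of Stirling's remainder with digamma *)

(** The interval for z contains both y + 1/3 and d(y), so one bound serves both inequalities. The
    errors 2, 2/2 and 1/2 add up to less than 4. *)
Lemma stirling_digamma_le y z : 1 < y -> y <= z <= y + 3^-1 ->
  `|stirling_log y - ln y / 2 + digamma z / 2| <= 4 / (y - 1).
Proof.
move=> y1 /andP[yz zy]; have y0 : 0 < y by rewrite (lt_trans _ y1).
have z1 : 1 < z by exact: lt_le_trans yz.
have z0 : 0 < z by exact: lt_le_trans yz.
have y10 : 0 < y - 1 by rewrite subr_gt0.
have h1 := stirling_log_le y1.
have h2 : `|digamma z - ln z| <= 2 / (y - 1).
  apply: le_trans (digamma_ln z1) _.
  by rewrite ler_pM2l// lef_pV2 ?posrE ?subr_gt0// lerD2r.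
have h3 : ln z - ln y <= 1 / (y - 1).
  apply: le_trans (lnB_le y0 z0) _.
  apply: ler_pM; rewrite ?invr_ge0 ?subr_ge0 ?(ltW y0)//.
    by clear -zy; lra.
  by rewrite lef_pV2 ?posrE// gerBl.
have h4 : 0 <= ln z - ln y by rewrite subr_ge0 ler_ln ?posrE.
have i0 : 0 < (y - 1)^-1 by rewrite invr_gt0.
move: h1 h2 h3 h4 i0; rewrite !ler_norml.
move: (stirling_log _) (digamma _) (ln _) (ln _) => a b c d.
move: ((y - 1)^-1) => i; clear.
by move=> /andP[? ?] /andP[? ?] *; apply/andP; split; lra.
Qed.

Lemma stirling_log_excess y : 0 < y ->
  (stirling_log y - ln y / 2) - (stirling_log (y + 1) - ln (y + 1) / 2) =
  ln_excess y.
Proof.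
move=> y0; have := stirling_logS y0; rewrite /ln_excess (addrC y 1).
move: (stirling_log _) (stirling_log _) (ln _) (ln _) => a b c d h.
rewrite [RHS](_ : _ = ((y + 1 / 2) * (d - c) - 1) + (d - c) / 2); last by field.
by rewrite -h; field.
Qed.

Lemma stirling_digamma_gt0 x : 0 < x ->
  0 < stirling_log x - ln x / 2 + digamma (x + 3^-1) / 2.
Proof.
move=> x0.
apply: (@gt0_shift_decreasing R
  (fun y => stirling_log y - ln y / 2 + digamma (y + 3^-1) / 2) 4) => //.
- move=> y y0; have y3 : 0 < y + 3^-1 by rewrite addr_gt0.
  have := ln_excess_gt y0; have := stirling_log_excess y0.
  rewrite [y + 1 + _]addrAC (digammaS y3).
  have -> : (2 * y + 2 / 3)^-1 = (y + 3^-1)^-1 / 2.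
    by rewrite -invfM; congr (_^-1); field.
  move: (stirling_log _ - _) (stirling_log _ - _) (digamma _) (ln_excess _).
  by move: (_^-1) => i a b c e; clear; lra.
- move=> y y1; apply: stirling_digamma_le => //.
  by rewrite lexx andbT lerDl invr_ge0.
Qed.

Lemma stirling_digamma_lt0 x : 0 < x ->
  stirling_log x - ln x / 2 + digamma (delta_upper x) / 2 < 0.
Proof.
move=> x0; rewrite -oppr_gt0.
apply: (@gt0_shift_decreasing R (fun y =>
  - (stirling_log y - ln y / 2 + digamma (delta_upper y) / 2)) 4) => //.
- move=> y y0; have /andP[dy _] := delta_upper_bounds y0.
  have d0 : 0 < delta_upper y by exact: lt_trans dy.
  have d1 : 0 < delta_upper y + 1 by rewrite addr_gt0.
  have := digamma_lt d1 (delta_upperS y0); rewrite (digammaS d0).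
  have := stirling_log_excess y0.
  (* Here 1/d(y) turns into 2g(y), so g(y) cancels against half of the recurrence term. *)
  rewrite {2}(delta_upperE y0) invrK.
  move: (stirling_log _ - _) (stirling_log _ - _) (ln_excess _).
  by move: (digamma _) (digamma _) => a b c d e; clear; lra.
- move=> y y1; rewrite normrN; apply: stirling_digamma_le => //.
  by have /andP[/ltW-> /ltW->] := delta_upper_bounds (lt_trans ltr01 y1).
Qed.

Lemma Gamma_stirling_log x : 0 < x ->
  Gamma x / (x `^ x * expR (- x) * Num.sqrt (2 * pi)) =
  expR (stirling_log x - ln x / 2).
Proof.
move=> x0; have p0 : 0 < 2 * pi :> R by rewrite mulr_gt0// pi_gt0.
have -> : Num.sqrt (2 * pi) = expR (ln (2 * pi) / 2) :> R.
  have s0 : 0 < Num.sqrt (2 * pi) :> R by rewrite sqrtr_gt0.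
  rewrite -{2}(sqr_sqrtr (ltW p0)) lnXn// -{1}(lnK s0); congr expR.
  by move: (ln _) => L; clear; field.
rewrite /powR gt_eqF// -(expR_lnGamma x0) -!expRD -expRN -expRD; congr expR.
rewrite /stirling_log; move: (lnGamma x) (ln _) (ln _) => a b c.
by field.
Qed.

End stirling.

Theorem theorem2p1 (R : realType) (x : R) (hx : 0 < x) :
  expR (- (1 / 2) * digamma (delta_lower x))
    < Gamma x / (x `^ x * expR (- x) * Num.sqrt (2 * pi))
  /\
  Gamma x / (x `^ x * expR (- x) * Num.sqrt (2 * pi))
    < expR (- (1 / 2) * digamma (delta_upper x)).
Proof.
rewrite (Gamma_stirling_log hx) !ltr_expR /delta_lower !div1r.
have := stirling_digamma_gt0 hx; have := stirling_digamma_lt0 hx.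
move: (stirling_log _ - _) (digamma _) (digamma _) => s a b.
by clear => *; split; lra.
Qed.
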